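(* Let $f:\mathbb{R}^d\to\mathbb{R}$ be twice continuously differentiable and bounded below, with gradient $g(x)=\nabla f(x)$ and Hessian $H(x)=\nabla^2 f(x)$. Assume there exists $0\le L_2<\infty$ such that for all $x\in\mathbb{R}^d$ and $t\ge0$, $\|H(x-t\,g(x))-H(x)\|\le t\,L_2\|g(x)\|$. Let $x^\star$ be a local minimum satisfying the second-order sufficient conditions $g(x^\star)=0$ and $H(x^\star)\succ0$. If $x_0$ is sufficiently close to $x^\star$, then the iterations $$x_{k+1}=x_k-s^{\rm MR}_k\,g(x_k),\qquad s^{\rm MR}_k=\frac{\langle g(x_k),H(x_k)g(x_k)\rangle}{\|H(x_k)g(x_k)\|^2},$$ converge linearly in the gradient norm: there exist constants $C>0$ and $q\in(0,1)$, independent of $k$, such that $\|g(x_k)\|\le C\,q^k\,\|g(x_0)\|$ for all $k\ge0$.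
   Context: Vector norms are Euclidean, matrix norms are spectral. If $g(x_k)=0$ at some $k$, the iteration stops (equivalently, $x_{j}=x_k$ for all $j\ge k$). *)

(* Defs.v *)
From HB Require Import structures.
From mathcomp Require Import all_boot all_order all_algebra.
From mathcomp Require Import all_classical all_reals all_analysis.

Set Implicit Arguments.
Unset Strict Implicit.
Unset Printing Implicit Defensive.

Import Order.TTheory GRing.Theory Num.Theory.
Import numFieldNormedType.Exports.

Local Open Scope classical_set_scope.
Local Open Scope ring_scope.

Section Euclidean.
Variables (R : realType) (d : nat).

Definition dot (u v : 'cV[R]_d) : R := \sum_(i < d) u i 0 * v i 0.

(* The library norm `|u| on matrices is the sup norm, hence this one. *)
Definition enorm (u : 'cV[R]_d) : R := Num.sqrt (dot u u).

(* The operator norm induced by [enorm]; the set is nonempty and bounded, so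
   [sup] is a genuine least upper bound. *)
Definition spnorm (A : 'M[R]_d) : R :=
  sup [set enorm (A *m v) | v in [set v | enorm v <= 1]].

(* Hessians of C^2 functions are symmetric, so only the quadratic form is
   constrained. *)
Definition posdef (A : 'M[R]_d) : Prop :=
  forall v : 'cV[R]_d, v != 0 -> 0 < dot v (A *m v).

End Euclidean.

Section Calculus.
Variables (R : realType) (d : nat).
Implicit Types (f : 'cV[R]_d -> R) (x : 'cV[R]_d).

Definition evec (i : 'I_d) : 'cV[R]_d := delta_mx i 0.

Definition grad f x : 'cV[R]_d := \col_i 'D_(evec i) f x.

Definition hess f x : 'M[R]_d := \matrix_(i, j) 'D_(evec i) ('D_(evec j) f) x.

(* Continuity here refers to the library topology on vectors and matrices, the
   one induced by any norm. *)
Definition C2 f : Prop :=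
  [/\ forall x, differentiable f x,
      forall x, differentiable (grad f) x
    & continuous (hess f)].

Definition local_minimum f x : Prop := \forall y \near x, f x <= f y.

End Calculus.

Section MinimalResidual.
Variables (R : realType) (d : nat) (f : 'cV[R]_d -> R).
Implicit Types x : 'cV[R]_d.

(* Division is total, with a / 0 = 0. If grad f x != 0 but
   hess f x *m grad f x = 0, the step is 0 and the iterates stall with a
   constant nonzero gradient; linear convergence thus excludes this case. *)
Definition sMR x : R :=
  dot (grad f x) (hess f x *m grad f x) / enorm (hess f x *m grad f x) ^+ 2.

Definition MR_update x : 'cV[R]_d :=
  if grad f x == 0 then x else x - sMR x *: grad f x.

Definition MR_iter (x0 : 'cV[R]_d) (k : nat) : 'cV[R]_d := iter k MR_update x0.

End MinimalResidual.

(* Main.v *)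
Require Import Defs.
From HB Require Import structures.
From mathcomp Require Import all_boot all_order all_algebra.
From mathcomp Require Import all_classical all_reals all_analysis.
From mathcomp Require Import ring lra.
Import Order.TTheory GRing.Theory Num.Theory.
Import numFieldNormedType.Exports.
Local Open Scope classical_set_scope.
Local Open Scope ring_scope.
Set Implicit Arguments.
Unset Strict Implicit.
Unset Printing Implicit Defensive.

(** Write [g] and [H] for the gradient and the Hessian at the current point.

    At [xstar] the quadratic form of the Hessian is bounded below by a positive
    multiple of the squared norm ([posdef_coercive]), and by continuity the
    Hessian is almost constant on a small ball ([hess_near]). On that ball
    [m |g|^2 <= g.Hg] and [|Hg| <= M |g|], so the step size [s], which minimizes
    the residual [|g - s Hg|], makes this residual at most
    [(1 - (m / M)^2 / 2) |g|] ([residual_contraction]).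

    The residual is the linearization of the gradient at the next iterate. Since
    [s <= 1 / m] and the Hessian hardly varies along the step, the linearization
    error is a small multiple of [|g|] ([grad_step_le]), so the gradient norm
    itself contracts by a factor [q < 1] ([MR_local_contraction]). This needs the
    derivative of the gradient in direction [v] to be [H v] rather than the
    transpose of [H] applied to [v], which is Schwarz's theorem ([hess_sym]).

    The iterates stay in the ball because the steps, of length at most
    [|g| / m], have a convergent geometric sum. The function
    [V x = |x - xstar| + |grad f x| / (m (1 - q))] encodes this: it does not
    increase along the iteration, and it is small at the start because the
    gradient is continuous and vanishes at [xstar]. *)

Lemma continuous_sum (R : realType) (T : topologicalType) n
    (F : 'I_n -> T -> R) :
  (forall i, continuous (F i)) -> continuous (fun x => \sum_i F i x).
Proof.
move=> Fc x; elim: n F Fc => [|n IHn] F Fc.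
  rewrite (_ : (fun _ => _) = cst 0); first exact: cvg_cst.
  by apply/funext => y; rewrite big_ord0.
rewrite (_ : (fun _ => _) = fun y =>
    F ord0 y + \sum_(i < n) F (lift ord0 i) y); last first.
  by apply/funext => y; rewrite big_ord_recl.
by apply: cvgD; [exact: Fc|apply: IHn => i; exact: Fc].
Qed.

(** * The Euclidean norm, compared with the sup norm *)

Section EuclideanNorm.
Variables (R : realType) (d : nat).
Implicit Types (u v w : 'cV[R]_d) (A B : 'M[R]_d) (a : R).

Lemma dotC u v : dot u v = dot v u.
Proof. by apply: eq_bigr => i _; rewrite mulrC. Qed.

Lemma dotDr u v w : dot u (v + w) = dot u v + dot u w.
Proof.
by rewrite /dot -big_split; apply: eq_bigr => i _; rewrite mxE mulrDr.
Qed.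

Lemma dotZr a u v : dot u (a *: v) = a * dot u v.
Proof.
by rewrite /dot mulr_sumr; apply: eq_bigr => i _; rewrite mxE mulrCA.
Qed.

Lemma dotBr u v w : dot u (v - w) = dot u v - dot u w.
Proof. by rewrite dotDr -scaleN1r dotZr mulN1r. Qed.

Lemma dotDl u v w : dot (u + v) w = dot u w + dot v w.
Proof. by rewrite !(dotC _ w) dotDr. Qed.

Lemma dotZl a u v : dot (a *: u) v = a * dot u v.
Proof. by rewrite !(dotC _ v) dotZr. Qed.

Lemma dotBl u v w : dot (u - v) w = dot u w - dot v w.
Proof. by rewrite !(dotC _ w) dotBr. Qed.

Lemma dot_ge0 u : 0 <= dot u u.
Proof. by apply: sumr_ge0 => i _; rewrite -expr2 sqr_ge0. Qed.

Lemma enorm_ge0 u : 0 <= enorm u.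
Proof. exact: sqrtr_ge0. Qed.

Lemma sqr_enorm u : enorm u ^+ 2 = dot u u.
Proof. by rewrite sqr_sqrtr ?dot_ge0. Qed.

Lemma enorm0 : enorm (0 : 'cV[R]_d) = 0.
Proof. by rewrite /enorm -(scale0r 0) dotZl mul0r sqrtr0. Qed.

Lemma enormZ a u : enorm (a *: u) = `|a| * enorm u.
Proof.
by rewrite /enorm dotZl dotZr mulrA -expr2 sqrtrM ?sqr_ge0// sqrtr_sqr.
Qed.

Lemma coord_le_enorm u i : `|u i 0| <= enorm u.
Proof.
rewrite -sqrtr_sqr ler_wsqrtr// /dot (bigD1 i)//= -expr2 lerDl.
by apply: sumr_ge0 => j _; rewrite -expr2 sqr_ge0.
Qed.

Lemma mx_norm_le_enorm u : `|u| <= enorm u.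
Proof.
rewrite [leLHS]/Num.norm/= mx_normrE; apply: bigmax_le; first exact: enorm_ge0.
by case=> i j _ /=; rewrite ord1 coord_le_enorm.
Qed.

Lemma coord_le_mx_norm m n (B : 'M[R]_(m, n)) i j : `|B i j| <= `|B|.
Proof.
rewrite [leRHS]/Num.norm/= mx_normrE.
exact: (le_bigmax _ (fun ij => `|B ij.1 ij.2|) (i, j)).
Qed.

Lemma enorm_gt0 u : u != 0 -> 0 < enorm u.
Proof.
by move=> u0; apply: lt_le_trans (mx_norm_le_enorm u); rewrite normr_gt0.
Qed.

Lemma sum_le_const (F : 'I_d -> R) c :
  (forall i, F i <= c) -> \sum_i F i <= d%:R * c.
Proof.
move=> Fc; rewrite mulr_natl -[X in _ *+ X](card_ord d) -sumr_const.
exact: ler_sum.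
Qed.

Lemma sqr_enorm_le u : enorm u ^+ 2 <= d%:R * `|u| ^+ 2.
Proof.
rewrite sqr_enorm; apply: sum_le_const => i.
by rewrite -expr2 -real_normK ?num_real// lerXn2r ?nnegrE// coord_le_mx_norm.
Qed.

Lemma enorm_le_mx_norm u : enorm u <= d%:R * `|u|.
Proof.
rewrite -ler_sqr ?nnegrE ?enorm_ge0 ?mulr_ge0//.
apply: le_trans (sqr_enorm_le u) _; rewrite exprMn ler_wpM2r ?sqr_ge0//.
by rewrite -natrX ler_nat; case: d => // n; rewrite leq_pmull.
Qed.

(** Expanding [0 <= |(u.u) v - (u.v) u|^2] gives [u.u] times the claim. *)
Lemma cauchy_schwarz u v : `|dot u v| <= enorm u * enorm v.
Proof.
have [->|u0] := eqVneq u 0.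
  by rewrite -(scale0r 0) dotZl mul0r normr0 mulr_ge0 ?enorm_ge0.
rewrite -ler_sqr ?nnegrE ?mulr_ge0 ?enorm_ge0// real_normK ?num_real//.
rewrite exprMn !sqr_enorm.
have : 0 <= dot (dot u u *: v - dot u v *: u) (dot u u *: v - dot u v *: u).
  exact: dot_ge0.
rewrite !(dotBl, dotBr, dotZl, dotZr) (dotC v u).
have : 0 < dot u u by rewrite -sqr_enorm exprn_gt0// enorm_gt0.
move: (dot u u) (dot v v) (dot u v) => a b c a0 h.
by rewrite -subr_ge0 -(pmulr_rge0 _ a0); move: h; congr (0 <= _); ring.
Qed.

Lemma dot_le u v : dot u v <= enorm u * enorm v.
Proof. exact: le_trans (ler_norm _) (cauchy_schwarz u v). Qed.

Lemma enormD u v : enorm (u + v) <= enorm u + enorm v.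
Proof.
rewrite -ler_sqr ?nnegrE ?addr_ge0 ?enorm_ge0// sqrrD !sqr_enorm.
rewrite dotDl !dotDr (dotC v u); have := dot_le u v; lra.
Qed.

(** The crude factor [d ^ 2] is harmless: the bound turns closeness in the sup
    norm, which is what continuity of the Hessian provides, into closeness as
    bilinear forms for the Euclidean norm. *)
Lemma bilinear_le A u v :
  `|dot u (A *m v)| <= d%:R ^+ 2 * `|A| * enorm u * enorm v.
Proof.
have Av i : `|(A *m v) i 0| <= d%:R * (`|A| * enorm v).
  rewrite mxE; apply: le_trans (ler_norm_sum _ _ _) _.
  apply: sum_le_const => j.
  by rewrite normrM ler_pM ?coord_le_mx_norm ?coord_le_enorm.
rewrite expr2 -!mulrA; apply: le_trans (ler_norm_sum _ _ _) _.
apply: sum_le_const => i.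
have -> : d%:R * (`|A| * (enorm u * enorm v)) =
  enorm u * (d%:R * (`|A| * enorm v)) by ring.
by rewrite normrM ler_pM// coord_le_enorm.
Qed.

(** The quadratic form attains a positive minimum on the compact unit sphere of
    the sup norm, and homogeneity extends the bound to every vector. In
    dimension 0 the sphere is empty and any constant works. *)
Lemma posdef_coercive A : posdef A ->
  exists2 m, 0 < m & forall v, m * enorm v ^+ 2 <= dot v (A *m v).
Proof.
move=> Apos.
pose phi (u : 'rV[R]_d) := dot u^T (A *m u^T).
have phi_cont : continuous phi.
  rewrite (_ : phi = fun u : 'rV[R]_d =>
    \sum_i u 0 i * \sum_j A i j * u 0 j); last first.
    apply/funext => u; apply: eq_bigr => i _; rewrite !mxE; congr (_ * _).
    by apply: eq_bigr => j _; rewrite mxE.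
  have coordc i : continuous (fun u : 'rV[R]_d => u 0 i).
    exact: coord_continuous.
  apply: (@continuous_sum R 'rV[R]_d) => i u.
  apply: continuousM; first exact: coordc.
  move: u; apply: (@continuous_sum R 'rV[R]_d) => j u.
  by apply: continuousM; [exact: cst_continuous|exact: coordc].
have phiZ a (u : 'rV[R]_d) : phi (a *: u) = a ^+ 2 * phi u.
  by rewrite /phi linearZ/= -scalemxAr dotZl dotZr mulrA.
have phi_gt0 (u : 'rV[R]_d) : u != 0 -> 0 < phi u.
  move=> u0; apply: Apos.
  by apply: contra_neq u0 => /(congr1 trmx); rewrite trmxK trmx0.
pose S := [set u : 'rV[R]_d | `|u| = 1].
have [Sne|S0] := pselect (S !=set0); last first.
  exists 1 => // v; have [->|v0] := eqVneq v 0.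
    by rewrite enorm0 expr0n mulr0 mulmx0 dot_ge0.
  exfalso; apply: S0; have vT0 : v^T != 0.
    by apply: contra_neq v0 => /(congr1 trmx); rewrite trmxK trmx0.
  exists (`|v^T|^-1 *: v^T); rewrite /S/= normrZ ger0_norm ?invr_ge0//.
  by rewrite mulVf// normr_eq0.
have Sc : compact S.
  apply: bounded_closed_compact.
    by exists 1; split => // M M1 u /= ->; exact: ltW.
  apply: (closed_comp (f := fun u : 'rV[R]_d => `|u|) (D := [set 1])).
    by move=> u _; exact: norm_continuous.
  exact: closed_eq.
have [u0 /set_mem u0S u0min] :=
  EVT_min_rV Sne Sc (continuous_subspaceT phi_cont).
have u0n : u0 != 0.
  by rewrite -normr_eq0 u0S oner_eq0.
have p0 := phi_gt0 _ u0n.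
exists (phi u0 / d.+1%:R); first by rewrite divr_gt0.
move=> v; have [->|v0] := eqVneq v 0.
  by rewrite enorm0 expr0n mulr0 mulmx0 dot_ge0.
have -> : dot v (A *m v) = phi v^T by rewrite /phi trmxK.
have vT0 : v^T != 0.
  by apply: contra_neq v0 => /(congr1 trmx); rewrite trmxK trmx0.
have vn : `|v^T| != 0 by rewrite normr_eq0.
have /mem_set/u0min : S (`|v^T|^-1 *: v^T).
  by rewrite /S/= normrZ ger0_norm ?invr_ge0// mulVf.
rewrite phiZ exprVn ler_pdivlMl ?exprn_gt0 ?normr_gt0// => h.
apply: le_trans h; rewrite mulrC mulrCA mulrC ler_pM2r//.
rewrite ler_pdivrMr//; apply: le_trans (sqr_enorm_le v) _.
rewrite mulrC ler_pM ?sqr_ge0 ?ler_nat//.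
rewrite lerXn2r ?nnegrE//.
rewrite [leLHS]/Num.norm/= mx_normrE; apply: bigmax_le => // -[i j] _ /=.
by have := coord_le_mx_norm v^T j i; rewrite mxE.
Qed.

Lemma coercive_perturbation A B (m m' : R) :
  (forall v, m * enorm v ^+ 2 <= dot v (A *m v)) ->
  (forall w v, `|dot w ((B - A) *m v)| <= m' * enorm w * enorm v) ->
  forall v, (m - m') * enorm v ^+ 2 <= dot v (B *m v).
Proof.
move=> coer BA v; have -> : B = A + (B - A) by rewrite addrC subrK.
rewrite mulmxDl dotDr; have := BA v v; have := coer v.
rewrite -mulrA -expr2 ler_norml; lra.
Qed.

(** The norm of [B v] is recovered by pairing it with itself. *)
Lemma bounded_perturbation A B (m' : R) : 0 <= m' ->
  (forall w v, `|dot w ((B - A) *m v)| <= m' * enorm w * enorm v) ->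
  forall v, enorm (B *m v) <= (d%:R ^+ 2 * `|A| + m') * enorm v.
Proof.
move=> m'0 BA v; set w := B *m v; have [->|wn0] := eqVneq w 0.
  by rewrite enorm0 mulr_ge0 ?enorm_ge0// addr_ge0// mulr_ge0 ?sqr_ge0.
rewrite -(ler_pM2l (enorm_gt0 wn0)) -expr2 sqr_enorm.
have -> : dot w w = dot w (A *m v) + dot w ((B - A) *m v).
  by rewrite -dotDr -mulmxDl addrC subrK.
apply: le_trans (lerD (le_trans (ler_norm _) (bilinear_le A w v))
  (le_trans (ler_norm _) (BA w v))) _.
by rewrite le_eqVlt; apply/orP; left; apply/eqP; ring.
Qed.

End EuclideanNorm.

(** * Mean values and the symmetry of the Hessian *)

Lemma mean_value_line (R : realType) (V : normedModType R) (F : V -> R) x v :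
  (forall y, differentiable F y) ->
  exists2 c, 0 < c < 1 & F (x + v) - F x = 'D_v F (x + c *: v).
Proof.
move=> dF; pose phi (t : R) := F (x + t *: v).
have dphi (t : R) : is_derive t (1:R) phi ('D_v F (x + t *: v)).
  have gr : (fun h : R => h^-1 *: (phi (h *: 1 + t) - phi t)) =
            (fun h => h^-1 *: (F (h *: v + (x + t *: v)) - F (x + t *: v))).
    apply/funext => h; congr (_ *: (F _ - _)).
    by rewrite [h *: 1]mulr1 scalerDl addrCA.
  apply: DeriveDef; last by rewrite /derive gr.
  by rewrite /derivable gr; apply: diff_derivable.
have phic : {within `[0, 1], continuous phi}.
  by apply: derivable_within_continuous => t _; have [] := dphi t.
have [c c01] := MVT ltr01 (fun t _ => dphi t) phic.
rewrite /phi scale1r scale0r addr0 subr0 mulr1 => ->.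
by exists c => //; rewrite in_itv in c01.
Qed.

Section Calculus.
Variables (R : realType) (d : nat).
Implicit Types (f : 'cV[R]_d -> R) (x v w : 'cV[R]_d).

Lemma derive_grad f x v : differentiable f x -> 'D_v f x = dot (grad f x) v.
Proof.
move=> df; rewrite deriveE// [in LHS](matrix_sum_delta v) linear_sum.
apply: eq_bigr => i _; rewrite big_ord1 linearZ/= mulrC mxE deriveE//.
Qed.

Lemma derive_scale f x a v :
  differentiable f x -> 'D_(a *: v) f x = a * 'D_v f x.
Proof. by move=> df; rewrite !deriveE// linearZ. Qed.

Lemma differentiable_partial f x i :
  differentiable (grad f) x -> differentiable ('D_(evec R i) f) x.
Proof.
move=> dg; rewrite (_ : 'D_(evec R i) f =
    (fun M : 'cV[R]_d => M i 0) \o grad f).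
  exact/differentiable_comp/differentiable_coord.
by apply/funext => y /=; rewrite mxE.
Qed.

(** The mean value theorem applied twice: to the increment of [f] in direction
    [j], moving along [i], and then to the [i]-th partial derivative along [j]. *)
Lemma second_difference f x i j h :
  (forall y, differentiable f y) -> (forall y, differentiable (grad f) y) ->
  0 < h ->
  exists2 p, `|p - x| <= h * (`|evec R i| + `|evec R j|) &
    f (x + h *: evec R i + h *: evec R j) - f (x + h *: evec R i)
      - f (x + h *: evec R j) + f x = h ^+ 2 * hess f p j i.
Proof.
move=> df dg h0; pose phi y := f (y + h *: evec R j) - f y.
have dshift y : differentiable (fun y => f (y + h *: evec R j)) y.
  exact: (@differentiable_comp _ _ _ _ (fun y => y + h *: evec R j) f).
have dphi y : differentiable phi y by exact: differentiableB.
have [c /andP[c0 c1] Ec] := mean_value_line x (h *: evec R i) dphi.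
set z := x + c *: (h *: evec R i) in Ec.
have dpi y : differentiable ('D_(evec R i) f) y.
  by exact: differentiable_partial.
have [e /andP[e0 e1] Ee] := mean_value_line z (h *: evec R j) dpi.
exists (z + e *: (h *: evec R j)).
  rewrite /z -(addrA x) [x + _]addrC addrK; apply: le_trans (ler_normD _ _) _.
  rewrite !normrZ !gtr0_norm// mulrDr lerD//.
    by apply: ler_piMl; rewrite ?mulr_ge0 ?(ltW h0)// ltW.
  by apply: ler_piMl; rewrite ?mulr_ge0 ?(ltW h0)// ltW.
have -> : f (x + h *: evec R i + h *: evec R j) - f (x + h *: evec R i)
      - f (x + h *: evec R j) + f x = phi (x + h *: evec R i) - phi x.
  by rewrite /phi; ring.
rewrite Ec derive_scale// deriveB; [|exact: diff_derivable..].
have -> : 'D_(evec R i) (fun y => f (y + h *: evec R j)) z =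
    'D_(evec R i) f (z + h *: evec R j).
  rewrite /derive.
  rewrite (_ : (fun _ => _) = (fun t => t^-1 *:
    (f (t *: evec R i + (z + h *: evec R j)) - f (z + h *: evec R j)))) //.
  by apply/funext => t; rewrite addrA.
by rewrite Ee derive_scale// mxE expr2 mulrA.
Qed.

(** Schwarz's theorem. The second difference in [second_difference] is symmetric
    in [i] and [j], so both mixed derivatives take a common value at points
    arbitrarily close to [x], and continuity carries this to [x]. *)
Lemma hess_sym f : C2 f -> forall x, (hess f x)^T = hess f x.
Proof.
move=> [df dg ch] x; apply/matrixP => i j.
have sd h k l := @second_difference f x k l h df dg.
(* [H] is now any continuous matrix field tied to [f] by [sd] alone. *)
move: (hess f) ch sd => H ch sd; rewrite mxE.
apply/eqP; rewrite -subr_eq0 -normr_eq0; apply/eqP/le_anti.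
rewrite normr_ge0 andbT; apply/ler_addgt0Pl => e e0; rewrite addr0.
have e2 : 0 < e / 2 by rewrite divr_gt0.
have /cvgrPdist_lt/(_ _ e2)/nbhs_ballP[r /= r0 hr] := ch x.
have rN i' j' p : `|p - x| < r -> `|H x i' j' - H p i' j'| < e / 2.
  move=> pr; have /hr : ball x r p by rewrite -ball_normE/= distrC.
  apply: le_lt_trans.
  by have := coord_le_mx_norm (H x - H p) i' j'; rewrite !mxE.
pose N := `|evec R i| + `|evec R j|.
have N0 : 0 <= N by rewrite addr_ge0.
have h0 : 0 < r / (N + 1) by rewrite divr_gt0 ?ltr_wpDl.
have hN : r / (N + 1) * N < r.
  by rewrite mulrAC ltr_pdivrMr ?ltr_wpDl// ltr_pM2l// ltrDl.
have [p pN Ep] := sd _ i j h0.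
have [p' pN' Ep'] := sd _ j i h0.
have E : H p j i = H p' i j.
  apply: (mulfI (_ : (r / (N + 1)) ^+ 2 != 0)).
    by rewrite expf_neq0// gt_eqF.
  by rewrite -Ep -Ep' (addrAC x); ring.
rewrite -/N in pN; rewrite [X in _ * X]addrC -/N in pN'.
have := rN j i p (le_lt_trans pN hN).
have := rN i j p' (le_lt_trans pN' hN).
rewrite E => h1 h2; rewrite (splitr e) -(subrKA (H p' i j)).
rewrite (le_trans (ler_normD _ _))// lerD ?ltW//.
by rewrite distrC.
Qed.

(** The mean value theorem fails for vector-valued maps, hence the pairing with a
    fixed [w]. Differentiating [dot w (grad f _)] produces the transpose of the
    Hessian, which [hess_sym] removes. *)
Lemma mean_value_grad f x v w : C2 f -> exists2 c, 0 < c < 1 &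
  dot w (grad f (x + v)) - dot w (grad f x) = dot w (hess f (x + c *: v) *m v).
Proof.
move=> f_C2; have [df dg _] := f_C2.
pose G j := w j 0 *: ('D_(evec R j) f).
have dG j y : differentiable (G j) y.
  exact/differentiableZ/differentiable_partial.
have GE : \sum_j G j = fun y => dot w (grad f y).
  apply/funext => y; rewrite fct_sumE; apply: eq_bigr => j _.
  by rewrite mxE.
have dF y : differentiable (\sum_j G j) y by exact: differentiable_sum.
have [c c01 Ec] := mean_value_line x v dF.
exists c => //; move: Ec; rewrite GE => ->; rewrite -GE derive_sum; last first.
  by move=> j; exact: diff_derivable.
apply: eq_bigr => j _; rewrite deriveZ; last first.
  exact/diff_derivable/differentiable_partial.
rewrite derive_grad; last exact: differentiable_partial.
rewrite -[hess f _](hess_sym f_C2) mxE; congr (_ * _).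
by apply: eq_bigr => i _; rewrite !mxE.
Qed.

(** Continuity of the Hessian, read on bilinear forms over a Euclidean ball. *)
Lemma hess_near f x (eps : R) : C2 f -> 0 < eps ->
  exists2 r, 0 < r & forall y, enorm (y - x) < r -> forall w v,
    `|dot w ((hess f y - hess f x) *m v)| <= eps * enorm w * enorm v.
Proof.
move=> [_ _ ch] eps_gt0; move: (hess f) ch => H ch.
have e0 : 0 < eps / (d%:R ^+ 2 + 1) by rewrite divr_gt0// ltr_wpDl ?sqr_ge0.
have /cvgrPdist_lt/(_ _ e0)/nbhs_ballP[r /= r0 hr] := ch x.
exists r => // y yr w v; apply: le_trans (bilinear_le _ _ _) _.
rewrite !ler_wpM2r ?enorm_ge0//.
have /hr/ltW : ball x r y.
  rewrite -ball_normE/= distrC; exact: le_lt_trans (mx_norm_le_enorm _) yr.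
rewrite distrC ler_pdivlMr ?ltr_wpDl ?sqr_ge0// mulrC; apply: le_trans.
by rewrite ler_wpM2r// lerDl.
Qed.

End Calculus.

(** * One minimal residual step *)

Section MinimalResidual.
Variables (R : realType) (d : nat).
Implicit Types (f : 'cV[R]_d -> R) (x g u v w : 'cV[R]_d) (A B : 'M[R]_d).

(** With [n = |g|], [a = g.Ag] and [b = |Ag|], the step [s = a / b^2] is the one
    that minimizes [|g - s Ag|], and [|g - s Ag|^2 = n^2 - (a / b)^2] by
    Pythagoras. The hypotheses give [a / b >= k n] with [k = m / M], and
    [1 - k^2 <= (1 - k^2 / 2)^2] avoids the square root. *)
Lemma residual_contraction A g m M (s := dot g (A *m g) / enorm (A *m g) ^+ 2) :
  0 < m -> 0 < M -> g != 0 ->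
  m * enorm g ^+ 2 <= dot g (A *m g) -> enorm (A *m g) <= M * enorm g ->
  [/\ 0 <= s, s <= m^-1
    & enorm (g - s *: (A *m g)) <= (1 - (m / M) ^+ 2 / 2) * enorm g].
Proof.
move=> m0 M0 g0 coer bnd.
have n0 := enorm_gt0 g0.
have agb := dot_le g (A *m g).
have sq : enorm (g - s *: (A *m g)) ^+ 2 =
    enorm g ^+ 2 - 2 * s * dot g (A *m g) + s ^+ 2 * enorm (A *m g) ^+ 2.
  rewrite !sqr_enorm dotBl !dotBr !dotZl !dotZr (dotC (A *m g) g); ring.
move: (enorm_ge0 (g - s *: (A *m g))) sq; rewrite {}/s.
move: (enorm (_ - _)) => t t0.
move: (dot g _) (enorm (A *m g)) (enorm g) coer bnd n0 agb =>
  a b n coer bnd n0 agb.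
have mnb : m * n <= b.
  by rewrite -(ler_pM2l n0); apply: le_trans agb; rewrite mulrCA -expr2.
have b0 : 0 < b by apply: lt_le_trans mnb; rewrite mulr_gt0.
have a0 : 0 < a by apply: lt_le_trans coer; rewrite mulr_gt0 ?exprn_gt0.
have -> : n ^+ 2 - 2 * (a / b ^+ 2) * a + (a / b ^+ 2) ^+ 2 * b ^+ 2 =
   n ^+ 2 - (a / b) ^+ 2 by field; rewrite gt_eqF.
move=> tE; split.
- by rewrite divr_ge0 ?sqr_ge0 ?ltW.
- rewrite ler_pdivrMr ?exprn_gt0// mulrC ler_pdivlMr//.
  apply: le_trans (_ : n * b * m <= _); first by rewrite ler_pM2r.
  by rewrite mulrAC expr2 ler_pM2r// mulrC.
- have ab : m / M * n <= a / b.
    rewrite [leLHS]mulrAC ler_pdivrMr// [leRHS]mulrAC ler_pdivlMr//.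
    apply: le_trans (_ : m * n * (M * n) <= _).
      by rewrite ler_pM2l ?mulr_gt0.
    by rewrite [leLHS](_ : _ = m * n ^+ 2 * M) ?ler_pM2r//; ring.
  set k := m / M in ab *.
  have k0 : 0 < k by rewrite divr_gt0.
  have k1 : k <= 1.
    rewrite /k ler_pdivrMr// mul1r -(ler_pM2r n0); exact: le_trans mnb bnd.
  have k2 : k ^+ 2 <= 1 by rewrite expr_le1 ?(ltW k0).
  rewrite -ler_sqr ?nnegrE//; last by rewrite mulr_ge0 ?(ltW n0)//; lra.
  rewrite tE exprMn.
  have : (k * n) ^+ 2 <= (a / b) ^+ 2.
    have kn0 := mulr_gt0 k0 n0; have adb0 := divr_gt0 a0 b0.
    by rewrite ler_sqr// nnegrE ltW.
  have := sqr_ge0 (k ^+ 2 * n); rewrite !exprMn; nra.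
Qed.

(** The residual [g - s Hg] is the linearization of the gradient at the new point;
    the error is read off [mean_value_grad] by pairing the new gradient with
    itself. *)
Lemma grad_step_le f x (s eta : R) : C2 f -> 0 <= s -> 0 <= eta ->
  (forall c w, 0 < c < 1 ->
    dot w ((hess f x - hess f (x - c *: (s *: grad f x))) *m grad f x)
      <= eta * enorm w * enorm (grad f x)) ->
  enorm (grad f (x - s *: grad f x))
    <= enorm (grad f x - s *: (hess f x *m grad f x))
       + s * eta * enorm (grad f x).
Proof.
move=> fC2 s0 eta0 Hdiff.
have [->|wn0] := eqVneq (grad f (x - s *: grad f x)) 0.
  by rewrite enorm0 addr_ge0 ?mulr_ge0 ?enorm_ge0.
rewrite -(ler_pM2l (enorm_gt0 wn0)) -expr2 sqr_enorm.
have [c c01 Ec] :=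
  mean_value_grad x (- (s *: grad f x)) (grad f (x - s *: grad f x)) fC2.
have {Hdiff} := Hdiff c (grad f (x - s *: grad f x)) c01.
rewrite scalerN in Ec; move: Ec.
move: (hess f (x - _)) (hess f x) (grad f (x - _)) => B A w.
move: (grad f x) => g.
rewrite mulmxN -scalemxAr => Ec hAB.
have -> : dot w w = dot w (g - s *: (A *m g)) + s * dot w ((A - B) *m g).
  move/eqP: Ec; rewrite subr_eq => /eqP ->.
  rewrite mulmxBl !dotBr -scaleN1r !dotZr; ring.
rewrite mulrDr lerD ?dot_le//.
have -> : enorm w * (s * eta * enorm g) = s * (eta * enorm w * enorm g).
  by ring.
by rewrite ler_wpM2l.
Qed.

(** The inequality on [x] keeps the whole step inside the ball of radius [r] about
    [xstar] on which the Hessian is almost constant. There, with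
    [k = (m / M) ^ 2], the residual is at most [(1 - k / 2) |g|] by
    [residual_contraction], and the linearization error of [grad_step_le] adds at
    most [(k / 4) |g|]. *)
Lemma MR_local_contraction f xstar : C2 f -> posdef (hess f xstar) ->
  exists m q r : R, [/\ 0 < m, 0 < q < 1, 0 < r &
    forall x, enorm (x - xstar) + enorm (grad f x) / m < r ->
      enorm (MR_update f x - x) <= enorm (grad f x) / m /\
      enorm (grad f (MR_update f x)) <= q * enorm (grad f x)].
Proof.
move=> fC2 /posdef_coercive[m0 m0_gt0 coer].
pose K := d%:R ^+ 2 * `|hess f xstar|.
have K0 : 0 <= K by rewrite mulr_ge0 ?sqr_ge0.
pose m := m0 / 2; pose M := K + m0.
have m_gt0 : 0 < m by rewrite divr_gt0.
have M_gt0 : 0 < M by rewrite ltr_wpDl.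
pose k := (m / M) ^+ 2.
have k_gt0 : 0 < k by rewrite exprn_gt0// divr_gt0.
have k_le1 : k <= 1.
  rewrite expr_le1// ?ltW ?divr_gt0// ltr_pdivrMr// mul1r /m /M; lra.
(* The linearization error is at most [2 eps s |g|] with [s <= 1 / m], hence at
   most [(k / 4) |g|] for this [eps]. *)
pose eps := m * k / 8.
have eps_gt0 : 0 < eps by rewrite !mulr_gt0// invr_gt0.
have eps_le : eps <= m by rewrite /eps; nra.
have [r r_gt0 near_H] := hess_near xstar fC2 eps_gt0.
exists m, (1 - k / 4), r; split => //; first by apply/andP; split; lra.
move=> x xr; set g := grad f x.
have gm0 : 0 <= enorm g / m by rewrite divr_ge0 ?enorm_ge0 ?ltW.
rewrite /MR_update -/g; case: eqP => [g0|/eqP g0].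
  by rewrite subrr enorm0 -/g g0 enorm0 mul0r mulr0.
have near_x : enorm (x - xstar) < r by apply: le_lt_trans xr; rewrite lerDl.
have coer_x : m * enorm g ^+ 2 <= dot g (hess f x *m g).
  apply: le_trans (coercive_perturbation coer (near_H x near_x) g).
  by rewrite ler_wpM2r ?sqr_ge0//; move: eps_le; rewrite /m; lra.
have bnd_x : enorm (hess f x *m g) <= M * enorm g.
  apply: le_trans (bounded_perturbation (ltW eps_gt0) (near_H x near_x) g) _.
  by rewrite ler_wpM2r ?enorm_ge0// lerD2l; move: eps_le; rewrite /m; lra.
have [s0 sm res] := residual_contraction m_gt0 M_gt0 g0 coer_x bnd_x.
rewrite -/(sMR f x) -/k in s0 sm res *; set s := sMR f x in s0 sm res *.
have sg : s * enorm g <= enorm g / m by rewrite mulrC ler_wpM2l ?enorm_ge0.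
split; first by rewrite addrC addKr -scaleN1r !enormZ normrN1 mul1r ger0_norm.
have seg c : 0 < c < 1 -> enorm (x - c *: (s *: g) - xstar) < r.
  move=> /andP[c0 c1]; rewrite addrAC; apply: le_lt_trans (enormD _ _) _.
  apply: le_lt_trans xr; rewrite lerD2l -scaleN1r !enormZ normrN1 mul1r.
  rewrite !ger0_norm ?(ltW c0)//; apply: le_trans sg.
  by rewrite ler_piMl ?(ltW c1)// mulr_ge0 ?enorm_ge0.
apply: le_trans (grad_step_le (eta := 2 * eps) fC2 s0 _ _) _ => [|c w c01|].
  by rewrite mulr_ge0 ?ltW.
  set y := x - _.
  have -> : hess f x - hess f y =
      (hess f x - hess f xstar) - (hess f y - hess f xstar).
    by rewrite opprB addrA subrK.
  have hx := le_trans (ler_norm _) (near_H x near_x w g).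
  have hy := near_H y (seg c c01) w g; rewrite -normrN in hy.
  rewrite -/g mulmxBl dotBr.
  apply: le_trans (lerD hx (le_trans (ler_norm _) hy)) _.
  by rewrite mulr_natl mulr2n !mulrDl.
rewrite -/g; apply: le_trans (lerD res (_ : _ <= k / 4 * enorm g)) _; last lra.
rewrite ler_wpM2r ?enorm_ge0//.
apply: le_trans (_ : m^-1 * (2 * eps) <= _).
  by rewrite ler_wpM2r// mulr_ge0 ?(ltW eps_gt0).
rewrite /eps le_eqVlt; apply/orP; left; apply/eqP; field; rewrite gt_eqF//.
Qed.

End MinimalResidual.

(** * Linear convergence *)

Theorem theorem3p9 (R : realType) (d : nat) (f : 'cV[R]_d -> R)
  (f_C2 : C2 f)
  (f_bounded_below : has_lbound (range f))
  (L2 : R) (L2_ge0 : 0 <= L2)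
  (f_smooth : forall (x : 'cV[R]_d) (t : R), 0 <= t ->
    spnorm (hess f (x - t *: grad f x) - hess f x)
      <= t * L2 * enorm (grad f x))
  (xstar : 'cV[R]_d)
  (xstar_min : local_minimum f xstar)
  (grad_xstar : grad f xstar = 0)
  (hess_xstar : posdef (hess f xstar)) :
  exists2 delta : R, 0 < delta &
    forall x0 : 'cV[R]_d, enorm (x0 - xstar) < delta ->
      exists C q : R, [/\ 0 < C, 0 < q < 1 &
        forall k : nat,
          enorm (grad f (MR_iter f x0 k)) <= C * q ^+ k * enorm (grad f x0)].
Proof.
have [m [q [r [m0 /andP[q0 q1] r0 step]]]] :=
  MR_local_contraction f_C2 hess_xstar.
pose p := m * (1 - q).
have p0 : 0 < p by rewrite mulr_gt0// subr_gt0.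
have pm : p <= m by rewrite ler_piMr ?(ltW m0)// gerBl ltW.
(* [V] does not increase along the iteration: the displacement, at most [|g| / m],
   is paid for by the decrease, at least [(1 - q) |g| / p], of its second term. *)
pose V x := enorm (x - xstar) + enorm (grad f x) / p.
have V_step x : V x < r -> V (MR_update f x) < r /\
    enorm (grad f (MR_update f x)) <= q * enorm (grad f x).
  move=> Vr.
  have /step[dx dg] : enorm (x - xstar) + enorm (grad f x) / m < r.
    apply: le_lt_trans Vr; rewrite lerD2l ler_wpM2l ?enorm_ge0//.
    by rewrite lef_pV2.
  split; last exact: dg.
  apply: le_lt_trans Vr; rewrite /V.
  rewrite -(subrKA x); apply: le_trans (lerD (enormD _ _) (lexx _)) _.
  rewrite addrAC addrC lerD2l.
  apply: le_trans (lerD dx (_ : _ <= q * enorm (grad f x) / p)) _.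
    by rewrite ler_pM2r ?invr_gt0.
  rewrite le_eqVlt; apply/orP; left; apply/eqP; rewrite /p; field.
  by rewrite subr_eq0 !gt_eqF.
have [_ dgrad _] := f_C2.
have d0 : 0 < 2 * (d%:R + 1) :> R by rewrite mulr_gt0// ltr_wpDl.
have e0 : 0 < p * r / (2 * (d%:R + 1)) := divr_gt0 (mulr_gt0 p0 r0) d0.
have /cvgrPdist_lt/(_ _ e0)/nbhs_ballP[r1 /= r10 hr1] :=
  differentiable_continuous (dgrad xstar).
exists (Num.min r1 (r / 2)); first by rewrite lt_min r10 divr_gt0.
move=> x0; rewrite lt_min => /andP[x0r1 x0r2].
exists 1, q; split => //; first by rewrite q0.
have V0 : V x0 < r.
  rewrite (splitr r) /V ltr_leD// ler_pdivrMr//.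
  have /hr1 : ball xstar r1 x0.
    rewrite -ball_normE/= distrC; exact: le_lt_trans (mx_norm_le_enorm _) x0r1.
  rewrite grad_xstar sub0r normrN ltr_pdivlMr// => h.
  apply: le_trans (enorm_le_mx_norm _) _.
  have := normr_ge0 (grad f x0); nra.
move=> k; rewrite mul1r.
suff [] : V (MR_iter f x0 k) < r /\
  enorm (grad f (MR_iter f x0 k)) <= q ^+ k * enorm (grad f x0) by [].
elim: k => [|k [IHV IHg]]; first by rewrite expr0 mul1r.
have [V1 g1] := V_step _ IHV; split; first exact: V1.
by apply: le_trans g1 _; rewrite exprS -mulrA ler_pM2l.
Qed.
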